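(* Let $m_1,m_2\in\mathbb{N}$, $\eta_1,\eta_2>0$, $\gamma_1,\gamma_2>0$, $0\le\alpha_1,\alpha_2\le1$, $s_1,s_2\in\mathbb{N}\cup\{0\}$, $\phi\in C(I^2)$ with $I^2=[0,1]\times[0,1]$, and $(z,y)\in I^2$. Then $$\left|\Re_{m_1,m_2,\eta_1,\eta_2,\gamma_1,\gamma_2}^{(\alpha_1,\alpha_2,s_1,s_2)}(\phi;z,y)-\phi(z,y)\right|\le 2\left(\omega_1\!\left(\phi,\sqrt{\varphi_{m_1,\eta_1,\gamma_1}^{(\alpha_1,s_1)}(z)}\right)+\omega_2\!\left(\phi,\sqrt{\varphi_{m_2,\eta_2,\gamma_2}^{(\alpha_2,s_2)}(y)}\right)\right),$$ where $\varphi_{m,\eta,\gamma}^{(\alpha,s)}(x)=\Re_{m,\eta,\gamma}^{(\alpha,s)}((t-x)^2;x)$ is the second central moment of the univariate operator, and $\omega_1,\omega_2$ are the partial moduli of continuity of $\phi$.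
   Context: $\mathbb{N}$ denotes the positive integers; $C[0,1]$ and $C(I^2)$ are the spaces of real-valued continuous functions on $[0,1]$ and $I^2=[0,1]\times[0,1]$. Binomial coefficients are $\binom{a}{b}=\frac{a!}{b!(a-b)!}$ if $0\le b\le a$ and $0$ otherwise; a term whose binomial coefficient is $0$ is understood to be $0$, and $0^0=1$. For $m\in\mathbb{N}$, $0\le j\le m$, $0\le\alpha\le1$, $s\in\mathbb{N}\cup\{0\}$ and $x\in[0,1]$ put: if $m<s$, $$q_{m,j}^{(\alpha,s)}(x)=\binom{m}{j}x^j(1-x)^{m-j};$$ if $m\ge s$, $$q_{m,j}^{(\alpha,s)}(x)=(1-\alpha)\binom{m-s}{j-s}x^{j-s+1}(1-x)^{m-j}+(1-\alpha)\binom{m-s}{j}x^{j}(1-x)^{m-s-j+1}+\alpha\binom{m}{j}x^j(1-x)^{m-j}.$$ Univariate operator ($\eta,\gamma>0$, $f\in C[0,1]$, $\Gamma$ the Gamma function): $$\Re_{m,\eta,\gamma}^{(\alpha,s)}(f;x)=\Gamma(\eta+1)\sum_{j=0}^{m}q_{m,j}^{(\alpha,s)}(x)\int_0^1\frac{(1-t)^{\eta-1}}{\Gamma(\eta)}\,f\!\left(\frac{j+t^{\gamma}}{m+1}\right)dt ;$$ $\Re_{m,\eta,\gamma}^{(\alpha,s)}((t-x)^2;x)$ means this operator applied to $t\mapsto(t-x)^2$ with $x$ fixed, evaluated at $x$. Bivariate operator ($\phi\in C(I^2)$, $(z,y)\in I^2$): $$\Re_{m_1,m_2,\eta_1,\eta_2,\gamma_1,\gamma_2}^{(\alpha_1,\alpha_2,s_1,s_2)}(\phi;z,y)=\Gamma(\eta_1+1)\Gamma(\eta_2+1)\sum_{j_1=0}^{m_1}\sum_{j_2=0}^{m_2}q_{m_1,j_1}^{(\alpha_1,s_1)}(z)\,q_{m_2,j_2}^{(\alpha_2,s_2)}(y)\int_0^1\!\!\int_0^1\frac{(1-t_1)^{\eta_1-1}}{\Gamma(\eta_1)}\frac{(1-t_2)^{\eta_2-1}}{\Gamma(\eta_2)}\,\phi\!\left(\frac{j_1+t_1^{\gamma_1}}{m_1+1},\frac{j_2+t_2^{\gamma_2}}{m_2+1}\right)dt_1\,dt_2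 .$$ Partial moduli of continuity, for $\rho_1,\rho_2>0$: $$\omega_1(\phi,\rho_1)=\sup\{|\phi(u_1,x)-\phi(u_2,x)|:x,u_1,u_2\in[0,1],\ |u_1-u_2|\le\rho_1\},$$ $$\omega_2(\phi,\rho_2)=\sup\{|\phi(x,v_1)-\phi(x,v_2)|:x,v_1,v_2\in[0,1],\ |v_1-v_2|\le\rho_2\}.$$ *)

(* Defs.v *)
From HB Require Import structures.
From mathcomp Require Import all_boot all_order all_algebra.
From mathcomp Require Import all_classical all_reals all_analysis.

Set Implicit Arguments.
Unset Strict Implicit.
Unset Printing Implicit Defensive.

Import Order.TTheory GRing.Theory Num.Theory.
Import numFieldNormedType.Exports.

Local Open Scope classical_set_scope.
Local Open Scope ring_scope.

Definition Gamma (R : realType) (a : R) : R :=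
  \int[lebesgue_measure]_(t in `]0, +oo[) (t `^ (a - 1) * expR (- t)).

(* The guard [s <= j] realizes the convention 'C(a, b) = 0 for b < 0: the
   truncated [j - s] would give 'C(m - s, 0) = 1 when j < s. In the other terms
   an exponent is truncated only when its binomial coefficient vanishes. *)
Definition basis_q (R : realType) (m : nat) (alpha : R) (s j : nat) (x : R) : R :=
  if (m < s)%N then
    'C(m, j)%:R * x ^+ j * (1 - x) ^+ (m - j)
  else
    (1 - alpha) * (if (s <= j)%N then
                     'C(m - s, j - s)%:R * x ^+ (j - s + 1) * (1 - x) ^+ (m - j)
                   else 0)
    + (1 - alpha) * ('C(m - s, j)%:R * x ^+ j * (1 - x) ^+ (m - s - j + 1))
    + alpha * ('C(m, j)%:R * x ^+ j * (1 - x) ^+ (m - j)).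

Definition rl_weight (R : realType) (eta t : R) : R :=
  (1 - t) `^ (eta - 1) / Gamma eta.

Definition node (R : realType) (m : nat) (gamma : R) (j : nat) (t : R) : R :=
  (j%:R + t `^ gamma) / m.+1%:R.

Definition op1 (R : realType) (m : nat) (eta gamma alpha : R) (s : nat)
    (f : R -> R) (x : R) : R :=
  Gamma (eta + 1) *
  \sum_(j < m.+1) basis_q m alpha s j x *
    \int[lebesgue_measure]_(t in `[0, 1])
      (rl_weight eta t * f (node m gamma j t)).

Definition op2 (R : realType) (m1 m2 : nat) (eta1 eta2 gamma1 gamma2 : R)
    (alpha1 alpha2 : R) (s1 s2 : nat) (phi : R * R -> R) (z y : R) : R :=
  Gamma (eta1 + 1) * Gamma (eta2 + 1) *
  \sum_(j1 < m1.+1) \sum_(j2 < m2.+1)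
    basis_q m1 alpha1 s1 j1 z * basis_q m2 alpha2 s2 j2 y *
    \int[lebesgue_measure]_(t2 in `[0, 1])
      \int[lebesgue_measure]_(t1 in `[0, 1])
        (rl_weight eta1 t1 * rl_weight eta2 t2 *
         phi (node m1 gamma1 j1 t1, node m2 gamma2 j2 t2)).

Definition second_moment (R : realType) (m : nat) (eta gamma alpha : R) (s : nat)
    (x : R) : R :=
  op1 m eta gamma alpha s (fun t => (t - x) ^+ 2) x.

Definition omega1 (R : realType) (phi : R * R -> R) (rho : R) : R :=
  sup [set r | exists x u1 u2 : R,
    [/\ x \in `[0, 1], u1 \in `[0, 1], u2 \in `[0, 1],
        `|u1 - u2| <= rho & r = `|phi (u1, x) - phi (u2, x)|]].

Definition omega2 (R : realType) (phi : R * R -> R) (rho : R) : R :=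
  sup [set r | exists x v1 v2 : R,
    [/\ x \in `[0, 1], v1 \in `[0, 1], v2 \in `[0, 1],
        `|v1 - v2| <= rho & r = `|phi (x, v1) - phi (x, v2)|]].

(* Main.v *)
(* The bivariate operator is the univariate one in the second variable applied to
   the univariate one in the first, so the bound reduces to
   |op1 f x - f x| <= 2 M whenever f moves by at most M over distances at most
   delta, the square root of the second moment.  The operator is positive and
   affine and fixes constants: this rests on the partition of unity of the
   [basis_q] and on Gamma (eta + 1) = eta * Gamma eta.  Chaining gives
   |f u - f x| <= ceil (|u - x| / delta) M <= M (1 + ((u - x) / delta)^2), and
   applying the operator yields M (1 + 1), with no need for Cauchy-Schwarz.
   Division by delta is legitimate since the second moment never vanishes: the
   nodes are injective in t. *)
Require Import Defs.
From mathcomp Require Import all_boot all_order all_algebra.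
From mathcomp Require Import all_classical all_reals all_analysis.
From mathcomp Require Import measurable_realfun ring lra.
Set Implicit Arguments.
Unset Strict Implicit.
Unset Printing Implicit Defensive.
Import Order.TTheory GRing.Theory Num.Theory.
Import numFieldNormedType.Exports.
Local Open Scope classical_set_scope.
Local Open Scope ring_scope.

(** * Improper integrals and the Gamma function *)

(** Monotone convergence along compact subintervals that exhaust the open one, on each of which the
    usual fundamental theorem applies. Only one-sided limits of [F] enter at the ends, so [f] may be
    unbounded there. *)
Lemma ge0_FTC2_oo (R : realType) (f F : R -> R) (a b la lb : R) : a < b ->
  (forall x, a < x < b -> 0 <= f x) ->
  (forall x, a < x < b -> {for x, continuous f}) ->
  (forall x, a < x < b -> is_derive x 1 F (f x)) ->
  F x @[x --> a^'+] --> la -> F x @[x --> b^'-] --> lb ->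
  (\int[lebesgue_measure]_(x in `]a, b[) (f x)%:E = (lb - la)%:E)%E.
Proof.
move=> ab f0 cf dF Fa Fb.
(* The offset 3 gives [d n + d n < b - a] already at [n = 0], so every [I n] is nondegenerate. *)
pose d n := (b - a) / n.+3%:R.
have d0 n : 0 < d n by rewrite divr_gt0// subr_gt0.
have d2 n : d n + d n < b - a.
  rewrite -mulrDl ltr_pdivrMr// -mulr2n -[ltLHS]mulr_natr ltr_pM2l ?subr_gt0//.
  by rewrite ltr_nat.
have dcvg : d n @[n --> \oo] --> 0.
  rewrite -[X in _ --> X](mulr0 (b - a)); apply: cvgMr.
  by have := @cvg_harmonic R; rewrite -(cvg_shiftn 2); under eq_fun do rewrite addn2.
pose I n : set R := `[a + d n, b - d n]%classic.
have subI n x : I n x -> a < x < b.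
  rewrite /I /= in_itv/= => /andP[h1 h2]; apply/andP; split.
    by apply: lt_le_trans h1; rewrite ltrDl.
  by apply: le_lt_trans h2 _; rewrite ltrBlDr ltrDl.
have ndI : nondecreasing_seq I.
  move=> m n mn; apply/subsetPset => x; rewrite /I /= !in_itv/= => /andP[h1 h2].
  have dd : d n <= d m.
    by rewrite ler_pM2l ?subr_gt0// lef_pV2 ?posrE// ler_nat !ltnS.
  apply/andP; split; first by apply: le_trans h1; rewrite lerD2l.
  by apply: le_trans h2 _; rewrite lerD2l lerN2.
have UI : \bigcup_n I n = `]a, b[%classic.
  apply/seteqP; split => [x [n _ /subI]|x]; rewrite /= in_itv//= => /andP[ax xb].
  have : \forall n \near \oo, d n < Num.min (x - a) (b - x).
    by apply: (cvgr_lt _ dcvg); rewrite lt_min !subr_gt0 ax.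
  case=> N _ /(_ N (leqnn N)); rewrite /= lt_min => /andP[h1 h2].
  by exists N => //; rewrite /I /= in_itv/=; apply/andP; split; lra.
have mI n : measurable_fun (I n) (EFin \o f).
  apply/measurable_EFinP; apply: (@measurable_funS _ _ _ _ `]a, b[%classic) => //.
    by move=> x /subI; rewrite /= in_itv.
  apply: open_continuous_measurable_fun; first exact: interval_open.
  by move=> x; rewrite inE /= in_itv/= => /cf.
have : (\int[lebesgue_measure]_(x in I i) (f x)%:E @[i --> \oo] -->
    \int[lebesgue_measure]_(x in \bigcup_i I i) (f x)%:E)%E.
  apply: ge0_nondecreasing_set_cvg_integral => //.
    by move=> i; exact: measurable_itv.
  move=> i x Ix.
  by rewrite lee_fin; exact: f0 (subI _ _ Ix).
rewrite UI => cvI; have cF x : a < x < b -> {for x, continuous F}.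
  by move=> /dF[+ _]; move/derivable1_diffP; exact: differentiable_continuous.
have an n : a < a + d n < b by have := d0 n; have := d2 n; move=> *; apply/andP; split; lra.
have bn n : a < b - d n < b by have := d0 n; have := d2 n; move=> *; apply/andP; split; lra.
have IE n : (\int[lebesgue_measure]_(x in I n) (f x)%:E =
    (F (b - d n) - F (a + d n))%:E)%E.
  rewrite EFinB; apply: continuous_FTC2.
  - by have := d2 n; lra.
  - apply: continuous_in_subspaceT => x; rewrite inE => /subI; exact: cf.
  - split.
    + move=> x xI; have /dF[//] : a < x < b.
      by apply: (subI n); rewrite /I /=; move: xI; rewrite !in_itv/= => /andP[/ltW -> /ltW ->].
    + exact/cvg_at_right_filter/cF.
    + exact/cvg_at_left_filter/cF.
  - move=> x xI; have /dF H : a < x < b.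
      by apply: (subI n); rewrite /I /=; move: xI; rewrite !in_itv/= => /andP[/ltW -> /ltW ->].
    by rewrite derive1E derive_val.
suff cvJ : (\int[lebesgue_measure]_(x in I i) (f x)%:E @[i --> \oo] --> (lb - la)%:E)%E.
  exact: (cvg_unique _ cvI cvJ).
under eq_cvg do rewrite IE.
apply: cvg_EFin; first exact: nearW.
apply: cvgB.
- move/cvg_at_leftP : Fb; apply; split; first by move=> n; have /andP[] := bn n.
  by rewrite -[X in _ --> X]subr0; apply: cvgB => //; exact: cvg_cst.
- move/cvg_at_rightP : Fa; apply; split; first by move=> n; have /andP[] := an n.
  by rewrite -[X in _ --> X]addr0; apply: cvgD => //; exact: cvg_cst.
Qed.

Lemma continuous_powR_gt0 (R : realType) (p x : R) : 0 < x ->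
  {for x, continuous (fun s : R => s `^ p)}.
Proof.
move=> x0; apply: differentiable_continuous; apply/derivable1_diffP.
by apply: derivable_powR; rewrite in_itv/= andbT.
Qed.

(** The interval is open at 0 because the integrand is unbounded there when [p < 1]. *)
Lemma integral_powR0 (R : realType) (p t : R) : 0 < p -> 0 < t ->
  (\int[lebesgue_measure]_(s in `]0%R, t[) (p * s `^ (p - 1))%:E = (t `^ p)%:E)%E.
Proof.
move=> p0 t0; rewrite -[in RHS](subr0 (t `^ p)).
apply: (@ge0_FTC2_oo R _ (fun s => s `^ p)) => //.
- by move=> x _; rewrite mulr_ge0 ?powR_ge0// ltW.
- move=> x /andP[x0 _]; apply: continuousM; first exact: cst_continuous.
  exact: continuous_powR_gt0.
- by move=> x /andP[x0 _]; exact: is_derive1_powR.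
- exact: powR_cvg0.
- exact/cvg_at_left_filter/continuous_powR_gt0.
Qed.

(** Source of the normalization of [rl_weight]. The antiderivative is minus the [p]-th power of
    [1 - t]; for [p < 1] the singularity sits at 1. *)
Lemma integral_powR_onem (R : realType) (p : R) : 0 < p ->
  (\int[lebesgue_measure]_(t in `]0%R, 1%R[) (p * (1 - t) `^ (p - 1))%:E = 1)%E.
Proof.
move=> p0.
have conem (x : R) : {for x, continuous (fun t : R => 1 - t)}.
  by apply: continuousB; [exact: cst_continuous|exact: cvg_id].
have -> : 1%E = (0 - (- 1))%:E :> \bar R by rewrite opprK add0r.
apply: (@ge0_FTC2_oo R _ (fun t => - (1 - t) `^ p)) => //.
- by move=> x _; rewrite mulr_ge0 ?powR_ge0// ltW.
- move=> x /andP[_ x1]; apply: continuousM; first exact: cst_continuous.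
  apply: (@continuous_comp _ _ _ (fun t : R => 1 - t) (fun s : R => s `^ (p - 1))) => //.
  by apply: continuous_powR_gt0; rewrite subr_gt0.
- move=> x /andP[_ x1].
  have y0 : 0 < 1 - x by rewrite subr_gt0.
  have d1 : is_derive x 1 (fun t : R => 1 - t) (- 1).
    have := is_deriveB (is_derive_cst (1 : R) x 1) (is_derive_id x 1).
    by rewrite sub0r.
  have d2 := is_derive1_powR p y0.
  have d3 := @is_derive1_comp R (fun s : R => s `^ p) (fun t : R => 1 - t) x (p * (1 - x) `^ (p - 1)) (- 1) d2 d1.
  have := is_deriveN d3.
  by rewrite mulrN1 opprK.
- apply: cvgN; apply: cvg_at_right_filter.
  suff : (fun t : R => (1 - t) `^ p) x @[x --> (0 : R)] --> (1 - 0 : R) `^ p.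
    by rewrite subr0 powR1.
  apply: (@continuous_comp _ _ _ (fun t : R => 1 - t) (fun s : R => s `^ p)) => //.
  by apply: continuous_powR_gt0; rewrite subr0.
- rewrite -[X in _ --> X]oppr0; apply: cvgN.
  (* The left limit at 1 is read along sequences: [1 - u n] tends to 0 from the right, where
     [powR_cvg0] applies. *)
  apply/cvg_at_leftP => u [u1 ucvg].
  move/cvg_at_rightP : (powR_cvg0 p0) => /(_ (fun n => 1 - u n)); apply; split.
    by move=> n; rewrite subr_gt0.
  by rewrite -[X in _ --> X](subrr 1); apply: cvgB => //; exact: cvg_cst.
Qed.

Lemma integral_expRN_tail (R : realType) (s : R) :
  (\int[lebesgue_measure]_(t in `]s, +oo[) (expR (- t))%:E = (expR (- s))%:E)%E.
Proof.
have cN : continuous (fun t : R => expR (- t)).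
  move=> z; apply: (@continuous_comp _ _ _ -%R expR); last exact: continuous_expR.
  exact: opp_continuous.
rewrite integral_itv_obnd_cbnd; last first.
  apply/measurable_EFinP; apply: measurable_funTS; exact: continuous_measurable_fun.
rewrite (@ge0_continuous_FTC2y R (fun x => expR (- x)) (fun x => - expR (- x)) s 0)//.
- by rewrite EFinN oppeK add0e.
- exact: continuous_subspaceT.
- by rewrite -[X in _ --> X]oppr0; apply: cvgN; exact: cvgr_expR.
- by apply: cvgN; exact/cvg_at_right_filter/cN.
- move=> x _.
  have := is_deriveN (@is_derive1_comp R expR -%R x _ _ (is_derive_expR (- x)) (is_deriveNid x 1)).
  by rewrite mulrN1 opprK derive1E => -[].
Qed.

(** The Gamma integral is kept in the extended reals so that Tonelli and comparison apply before
    finiteness is known; [GammaE] then carries the results over to [Gamma]. *)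
Definition eGamma (R : realType) (a : R) : \bar R :=
  (\int[lebesgue_measure]_(t in `]0%R, +oo[) (t `^ (a - 1) * expR (- t))%:E)%E.

Lemma measurable_expRN (R : realType) : measurable_fun [set: R] (fun t => expR (- t)).
Proof. exact: measurableT_comp. Qed.

Lemma measurable_gamma_integrand (R : realType) (D : set R) (a : R) :
  measurable_fun D (fun t => t `^ a * expR (- t)).
Proof.
apply: measurable_funTS; apply: measurable_funM => //.
exact: measurable_expRN.
Qed.

(* Tonelli on the region 0 < s < t, with [t `^ a] the integral of [a * s `^ (a - 1)]
   over ]0, t[. *)
Lemma eGammaS (R : realType) (a : R) : 0 < a ->
  eGamma (a + 1) = (a%:E * eGamma a)%E.
Proof.
move=> a0.
pose k (p : R * R) : R :=
  if (0 < p.2) && (p.2 < p.1) then expR (- p.1) * (a * p.2 `^ (a - 1)) else 0.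
have k0 p : (0 <= (k p)%:E)%E.
  by rewrite lee_fin /k; case: ifP => // _; rewrite !mulr_ge0 ?expR_ge0 ?powR_ge0// ltW.
have mk : measurable_fun setT (EFin \o k).
  apply/measurable_EFinP; apply: measurable_fun_ifT => //.
    apply: measurable_and; apply: measurable_fun_ltr => //.
  apply: measurable_funM.
    exact: (measurableT_comp (@measurable_expRN R)).
  apply: measurable_funM => //.
  exact: (measurableT_comp (measurable_powR (a - 1))).
have inner1 t : (\int[lebesgue_measure]_s (k (t, s))%:E =
    ((fun t => (t `^ a * expR (- t))%:E) \_ `]0%R, +oo[) t)%E.
  transitivity (\int[lebesgue_measure]_(s in `]0%R, t[)
     ((expR (- t))%:E * (a * s `^ (a - 1))%:E))%E.
    rewrite [RHS]integral_mkcond; apply: eq_integral => s _.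
    by rewrite patchE mem_setE in_itv /k/=; case: ifP.
  rewrite patchE mem_setE in_itv/= andbT; case: ifP => t0; last first.
    by rewrite set_itv_ge ?integral_set0// bnd_simp t0.
  rewrite ge0_integralZl_EFin//; last 2 first.
    by move=> s _; rewrite lee_fin mulr_ge0 ?powR_ge0// ltW.
    by apply/measurable_EFinP; apply: measurable_funTS; apply: measurable_funM.
  by rewrite integral_powR0// -EFinM mulrC.
have inner2 s : (\int[lebesgue_measure]_t (k (t, s))%:E =
    ((fun s => a%:E * (s `^ (a - 1) * expR (- s))%:E) \_ `]0%R, +oo[) s)%E.
  rewrite patchE mem_setE in_itv/= andbT; case: ifP => s0; last first.
    by rewrite integral0_eq// => t _; rewrite /k/= s0.
  transitivity (\int[lebesgue_measure]_(t in `]s, +oo[)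
     ((a * s `^ (a - 1))%:E * (expR (- t))%:E))%E.
    rewrite [RHS]integral_mkcond; apply: eq_integral => t _.
    by rewrite patchE mem_setE in_itv /k/= s0 andbT/= mulrC; case: ifP.
  rewrite ge0_integralZl_EFin//; last 2 first.
    by apply/measurable_EFinP; apply: measurable_funTS; exact: measurable_expRN.
    by rewrite mulr_ge0 ?powR_ge0// ltW.
  by rewrite integral_expRN_tail -!EFinM mulrA.
transitivity (\int[lebesgue_measure]_t \int[lebesgue_measure]_s (k (t, s))%:E)%E.
  by under [RHS]eq_integral do rewrite inner1; rewrite -integral_mkcond /eGamma addrK.
rewrite (fubini_tonelli (m1 := lebesgue_measure) (m2 := lebesgue_measure) _ mk k0).
under eq_integral do rewrite inner2.
rewrite -integral_mkcond.
rewrite ge0_integralZl_EFin//; last 3 first.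
  by move=> t _; rewrite lee_fin mulr_ge0 ?powR_ge0 ?expR_ge0.
  by apply/measurable_EFinP; exact: measurable_gamma_integrand.
  exact: ltW.
Qed.

(** On []0, 1[] the exponential factor is at least [expR (- 1)], which leaves at least
    [expR (- 1) / a]. *)
Lemma eGamma_gt0 (R : realType) (a : R) : 0 < a -> (0 < eGamma a)%E.
Proof.
move=> a0.
apply: (@lt_le_trans _ _ (expR (- 1) / a)%:E).
  by rewrite lte_fin divr_gt0// expR_gt0.
apply: (@le_trans _ _ (\int[lebesgue_measure]_(t in `]0%R, 1%R[)
    (t `^ (a - 1) * expR (- t))%:E)%E); last first.
  apply: ge0_subset_integral => //=.
  - by apply/measurable_EFinP; exact: measurable_gamma_integrand.
  - by move=> t _; rewrite lee_fin mulr_ge0 ?powR_ge0 ?expR_ge0.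
  - by apply: subset_itvl; rewrite bnd_simp.
have mp : measurable_fun (`]0, 1[ : set R) (fun s => (a * s `^ (a - 1))%:E).
  by apply/measurable_EFinP; apply: measurable_funTS; apply: measurable_funM.
have c0 : 0 <= expR (- 1) / a by rewrite divr_ge0 ?expR_ge0// ltW.
have -> : (expR (- 1) / a)%:E = (\int[lebesgue_measure]_(s in `]0%R, 1%R[)
    ((expR (- 1) / a)%:E * (a * s `^ (a - 1))%:E))%E.
  rewrite ge0_integralZl_EFin//.
    by rewrite integral_powR0// powR1 mule1.
  by move=> s _; rewrite lee_fin mulr_ge0 ?powR_ge0// ltW.
apply: ge0_le_integral => //=.
- by move=> s _; rewrite -EFinM lee_fin !mulr_ge0 ?powR_ge0 ?expR_ge0 ?invr_ge0 ?ltW.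
- exact: measurable_funeM.
- by apply/measurable_EFinP; exact: measurable_gamma_integrand.
- move=> s; rewrite in_itv/= => /andP[s0 s1]; rewrite -EFinM lee_fin.
  rewrite mulrA divfK ?gt_eqF// mulrC ler_wpM2l ?powR_ge0//.
  by rewrite ler_expR lerN2 ltW.
Qed.

Lemma eGamma_nat_lty (R : realType) (n : nat) : (eGamma (n.+1%:R : R) < +oo)%E.
Proof.
elim: n => [|n IHn]; last by rewrite -natr1 eGammaS// lte_mul_pinfty.
rewrite /eGamma subrr; under eq_integral do rewrite powRr0 mul1r.
by rewrite integral_expRN_tail ltry.
Qed.

(** For [b >= 1], the power of [t] with exponent [b - 1] is at most 1 plus the [n]-th power once
    [n >= b - 1], so integer arguments dominate. A general [a] is reached from [a + 1] by the
    recurrence: an infinite value at [a] would make the value at [a + 1] infinite. *)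
Lemma eGamma_lty (R : realType) (a : R) : 0 < a -> (eGamma a < +oo)%E.
Proof.
move=> a0.
suff ge1 (b : R) : 1 <= b -> (eGamma b < +oo)%E.
  have : (eGamma (a + 1) < +oo)%E by apply: ge1; rewrite lerDr ltW.
  rewrite eGammaS//; have := eGamma_gt0 a0.
  by case: (eGamma a) => [r| |]//= _; rewrite ?ltry// gt0_muley// lte_fin.
move=> b1; pose n := Num.bound b.
have bn : b - 1 <= n%:R.
  have := ltW (archi_boundP (le_trans ler01 b1)); rewrite -/n; lra.
have pos c (t : R) : (0 <= (t `^ c * expR (- t))%:E)%E.
  by rewrite lee_fin mulr_ge0 ?powR_ge0 ?expR_ge0.
have ms c : measurable_fun (`]0, +oo[ : set R) (fun t => (t `^ c * expR (- t))%:E).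
  by apply/measurable_EFinP; exact: measurable_gamma_integrand.
apply: (@le_lt_trans _ _ (eGamma (1 : R) + eGamma (n.+1%:R : R))%E); last first.
  by rewrite lte_add_pinfty// ?(@eGamma_nat_lty _ 0)// eGamma_nat_lty.
rewrite /eGamma -ge0_integralD//=; [|exact: ms..].
apply: ge0_le_integral => //=; [exact: ms|by apply: emeasurable_funD; exact: ms|].
move=> t; rewrite in_itv/= andbT => t0; rewrite -EFinD lee_fin -mulrDl.
rewrite ler_wpM2r ?expR_ge0// subrr powRr0 -natr1 addrK.
have [t1|t1] := leP t 1.
  rewrite (@le_trans _ _ 1)//; last by rewrite lerDl powR_ge0.
  suff : t `^ (b - 1) <= 1 `^ (b - 1) by rewrite powR1.
  by rewrite ge0_ler_powR ?nnegrE ?subr_ge0// ltW.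
rewrite (@le_trans _ _ (t `^ n%:R))//; last by rewrite lerDr.
by rewrite ler_powR// ltW.
Qed.

Lemma GammaE (R : realType) (a : R) : 0 < a -> (Gamma a)%:E = eGamma a.
Proof.
move=> a0; rewrite /Gamma /Rintegral fineK// ge0_fin_numE ?eGamma_lty//.
exact/ltW/eGamma_gt0.
Qed.

Lemma Gamma_gt0 (R : realType) (a : R) : 0 < a -> 0 < Gamma a.
Proof. by move=> a0; rewrite -lte_fin GammaE// eGamma_gt0. Qed.

Lemma GammaS (R : realType) (a : R) : 0 < a -> Gamma (a + 1) = a * Gamma a.
Proof.
move=> a0; apply: EFin_inj; rewrite EFinM !GammaE ?eGammaS//.
by rewrite addr_gt0.
Qed.

(** * The fractional integration weight and its total mass *)

Lemma rl_weight_ge0 (R : realType) (eta t : R) : 0 < eta -> 0 <= rl_weight eta t.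
Proof. by move=> h; rewrite divr_ge0 ?powR_ge0// ltW// Gamma_gt0. Qed.

Lemma measurable_rl_weight (R : realType) (D : set R) (eta : R) :
  measurable_fun D (rl_weight eta).
Proof.
apply: measurable_funTS; apply: measurable_funM => //.
apply: (measurableT_comp (measurable_powR (eta - 1))).
exact: measurable_funB.
Qed.

Lemma integral_rl_weight (R : realType) (eta : R) : 0 < eta ->
  (\int[lebesgue_measure]_(t in `[0%R, 1%R]) (rl_weight eta t)%:E =
   ((Gamma (eta + 1))^-1)%:E)%E.
Proof.
move=> h; have G0 := Gamma_gt0 h.
(* Dropping the null endpoints removes [t = 1], where the power of 0 takes a conventional value if
   [eta < 1]. *)
rewrite integral_itv_bndoo; last first.
  by apply/measurable_EFinP; exact: measurable_rl_weight.
transitivity (\int[lebesgue_measure]_(t in `]0%R, 1%R[)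
    (((Gamma (eta + 1))^-1)%:E * (eta * (1 - t) `^ (eta - 1))%:E))%E.
  apply: eq_integral => t _; rewrite -EFinM; congr EFin.
  by rewrite GammaS// /rl_weight; field; rewrite !gt_eqF.
rewrite ge0_integralZl_EFin//.
- by rewrite integral_powR_onem// mule1.
- by move=> t _; rewrite lee_fin mulr_ge0 ?powR_ge0// ltW.
- apply/measurable_EFinP; apply: measurable_funTS; apply: measurable_funM => //.
  apply: (measurableT_comp (measurable_powR (eta - 1))).
  exact: measurable_funB.
- by rewrite invr_ge0 ltW// Gamma_gt0// addr_gt0.
Qed.

(** * The basis functions *)

Lemma basis_q_ge0 (R : realType) (m : nat) (alpha : R) (s j : nat) (x : R) :
  0 <= alpha <= 1 -> 0 <= x <= 1 -> 0 <= basis_q m alpha s j x.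
Proof.
move=> /andP[a0 a1] /andP[x0 x1].
have a1' : 0 <= 1 - alpha by rewrite subr_ge0.
have x1' : 0 <= 1 - x by rewrite subr_ge0.
rewrite /basis_q; case: ifP => _; first by rewrite !mulr_ge0 ?exprn_ge0.
rewrite !addr_ge0 ?mulr_ge0 ?exprn_ge0//.
by case: ifP => // _; rewrite !mulr_ge0 ?exprn_ge0.
Qed.

Lemma sum_bernstein (R : comPzRingType) (n : nat) (x : R) :
  \sum_(j < n.+1) 'C(n, j)%:R * x ^+ j * (1 - x) ^+ (n - j) = 1.
Proof.
rewrite -[RHS](expr1n _ n) -[in RHS](subrK x 1) exprDn; apply: eq_bigr => j _.
by rewrite -mulrA mulr_natl mulrC.
Qed.

(** For [s <= m] the three families sum to [x], [1 - x] and 1, and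
    [(1 - alpha) * (x + (1 - x)) + alpha = 1]. *)
Lemma sum_basis_q (R : realType) (m : nat) (alpha : R) (s : nat) (x : R) :
  \sum_(j < m.+1) basis_q m alpha s j x = 1.
Proof.
rewrite /basis_q; case: ltnP => [_|sm]; first exact: sum_bernstein.
rewrite !big_split/= -!mulr_sumr sum_bernstein mulr1.
pose n := (m - s)%N; have mE : m = (n + s)%N by rewrite subnK.
(* The guard kills the indices below [s]; shifting by [s] leaves [x] times the Bernstein sum of
   degree [n]. *)
have -> : \sum_(j < m.+1) (if (s <= j)%N then
    'C(m - s, j - s)%:R * x ^+ (j - s + 1) * (1 - x) ^+ (m - j) else 0) = x.
  rewrite -(big_mkord xpredT (fun j => if (s <= j)%N then
    'C(m - s, j - s)%:R * x ^+ (j - s + 1) * (1 - x) ^+ (m - j) else 0)).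
  rewrite (big_cat_nat (n := s))//=; last exact: leqW.
  rewrite big_nat big1 ?add0r => [|j /andP[_ js]]; last by rewrite leqNgt js.
  rewrite -{1}[s]add0n big_addn big_mkord subSn// -/n.
  rewrite -[RHS]mulr1 -[X in _ = _ * X](sum_bernstein n x) mulr_sumr.
  apply: eq_bigr => j _; rewrite leq_addl addnK addn1 exprS.
  rewrite mE subnDr.
  by ring.
(* The binomials vanish beyond [n]; every remaining term is a Bernstein term of degree [n] with one
   more factor [1 - x]. *)
have -> : \sum_(j < m.+1) 'C(m - s, j)%:R * x ^+ j * (1 - x) ^+ (m - s - j + 1) = 1 - x.
  rewrite -/n -(big_mkord xpredT (fun j => 'C(n, j)%:R * x ^+ j * (1 - x) ^+ (n - j + 1))).
  rewrite (big_cat_nat (n := n.+1))//=; last by rewrite ltnS leq_subr.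
  rewrite [X in _ + X]big_nat [X in _ + X]big1 ?addr0; last first.
    by move=> j /andP[nj _]; rewrite bin_small// !mul0r.
  rewrite big_mkord -[RHS]mulr1 -[X in _ = _ * X](sum_bernstein n x) mulr_sumr.
  by apply: eq_bigr => j _; rewrite addn1 exprS; ring.
by ring.
Qed.

(** * The univariate operator *)

(** Measurability on the whole line composes freely with the nodes. The bound is asked on [[0, 1]]
    only, where the nodes lie, so that the unbounded test function [(u - x) ^+ 2] qualifies. *)
Definition bounded_measurable01 (R : realType) (f : R -> R) : Prop :=
  measurable_fun [set: R] f /\ exists M : R, forall u : R, 0 <= u <= 1 -> `|f u| <= M.

Lemma node_itv01 (R : realType) (m : nat) (gamma : R) (j : 'I_m.+1) (t : R) :
  0 < gamma -> 0 <= t <= 1 -> 0 <= node m gamma j t <= 1.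
Proof.
move=> g0 /andP[t0 t1]; rewrite /node divr_ge0 ?addr_ge0 ?powR_ge0//=.
rewrite ler_pdivrMr// mul1r -natr1 lerD ?ler_nat ?leq_ord//.
suff : t `^ gamma <= 1 `^ gamma by rewrite powR1.
by rewrite ge0_ler_powR ?nnegrE ?(ltW g0).
Qed.

Lemma measurable_node (R : realType) (m : nat) (gamma : R) (j : nat) (D : set R) :
  measurable_fun D (node m gamma j).
Proof.
apply: measurable_funTS; apply: measurable_funM => //; exact: measurable_funD.
Qed.

Lemma integrable_rl_weight (R : realType) (eta : R) : 0 < eta ->
  lebesgue_measure.-integrable `[0%R, 1%R] (EFin \o rl_weight eta).
Proof.
move=> h; apply/integrableP; split.
  by apply/measurable_EFinP; exact: measurable_rl_weight.
under eq_integral do rewrite /= ger0_norm ?rl_weight_ge0//.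
by rewrite integral_rl_weight// ltry.
Qed.

(** Domination by [M] times the integrable weight, since the nodes stay in [[0, 1]]. *)
Lemma integrable_rl_weight_node (R : realType) (m : nat) (eta gamma : R)
    (j : 'I_m.+1) (f : R -> R) :
  0 < eta -> 0 < gamma -> bounded_measurable01 f ->
  lebesgue_measure.-integrable `[0%R, 1%R]
    (EFin \o (fun t => rl_weight eta t * f (node m gamma j t))).
Proof.
move=> h g [mf [M fM]].
have iM : lebesgue_measure.-integrable `[0%R, 1%R]
    (EFin \o (fun t => rl_weight eta t * M)).
  by have iw := integrable_rl_weight h; exact: (integrableZr _ M iw).
apply: le_integrable iM => //.
- apply/measurable_EFinP; apply: measurable_funM; first exact: measurable_rl_weight.
  by apply: measurableT_comp mf _; exact: measurable_node.
- move=> t; rewrite /= in_itv/= => t01; rewrite lee_fin !normrM.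
  rewrite ler_wpM2l// (le_trans (fM _ _)) ?ler_norm//.
  exact: node_itv01.
Qed.

Section op1_theory.
Context {R : realType} (m : nat) (eta gamma alpha : R) (s : nat) (x : R).
Hypotheses (heta : 0 < eta) (hgamma : 0 < gamma)
  (halpha : 0 <= alpha <= 1) (hx : 0 <= x <= 1).

Lemma op1_le (f g : R -> R) : bounded_measurable01 f -> bounded_measurable01 g ->
  (forall u, 0 <= u <= 1 -> f u <= g u) ->
  op1 m eta gamma alpha s f x <= op1 m eta gamma alpha s g x.
Proof.
move=> bf bg fg; rewrite ler_wpM2l ?(ltW (Gamma_gt0 _)) ?addr_gt0//.
apply: ler_sum => j _; rewrite ler_wpM2l ?basis_q_ge0//.
apply: le_Rintegral => //; [exact: integrable_rl_weight_node..|].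
move=> t; rewrite /= in_itv/= => t01; rewrite ler_wpM2l ?rl_weight_ge0//.
by apply: fg; exact: node_itv01.
Qed.

(** The constant contributes [c / Gamma (eta + 1)] for each [j]; the partition of unity and the
    prefactor turn this back into [c]. *)
Lemma op1_affine (c k : R) (f : R -> R) : bounded_measurable01 f ->
  op1 m eta gamma alpha s (fun u => c + k * f u) x =
  c + k * op1 m eta gamma alpha s f x.
Proof.
move=> bf; have G0 : 0 < Gamma (eta + 1) by rewrite Gamma_gt0 ?addr_gt0.
pose I j := \int[lebesgue_measure]_(t in `[0, 1]) (rl_weight eta t * f (node m gamma j t)).
transitivity (Gamma (eta + 1) * \sum_(j < m.+1) basis_q m alpha s j x *
    (c / Gamma (eta + 1) + k * I j)).
  congr (_ * _); apply: eq_bigr => j _; congr (_ * _).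
  transitivity (\int[lebesgue_measure]_(t in `[0, 1])
      (rl_weight eta t * c + k * (rl_weight eta t * f (node m gamma j t)))).
    by apply: eq_Rintegral => t _; rewrite mulrDr (mulrCA k).
  have iw := integrable_rl_weight heta.
  have iwf := integrable_rl_weight_node j heta hgamma bf.
  rewrite RintegralD//=; last 2 first.
    exact: (integrableZr _ c iw).
    exact: (integrableZl _ k iwf).
  rewrite RintegralZr// RintegralZl//; congr (_ + _).
  by rewrite /Rintegral integral_rl_weight// mulrC.
under eq_bigr do rewrite mulrDr (mulrCA _ k).
rewrite big_split/= -mulr_suml -mulr_sumr sum_basis_q mul1r mulrDr.
by rewrite mulrC divfK ?gt_eqF// mulrCA.
Qed.
End op1_theory.

(** * Strict positivity of the second moment *)

Lemma node_inj (R : realType) (m : nat) (gamma : R) (j : nat) (t u : R) :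
  0 < gamma -> 0 <= t -> 0 <= u -> node m gamma j t = node m gamma j u -> t = u.
Proof.
move=> g t0 u0 /(congr1 (fun v => v * m.+1%:R)).
by rewrite /node !divfK ?pnatr_eq0// => /addrI; apply: powR_injective.
Qed.

Lemma bounded_measurable01_sqr (R : realType) (x : R) : 0 <= x <= 1 ->
  bounded_measurable01 (fun u => (u - x) ^+ 2).
Proof.
move=> x01; split.
  by apply: (measurable_funX 2); exact: measurable_funB.
exists 1 => u /andP[u0 u1]; rewrite ger0_norm ?sqr_ge0//.
by case/andP: x01 => x0 x1; nra.
Qed.

(** A zero integral would make the integrand vanish almost everywhere; but the weight is positive
    for [t < 1] and the node equals [x] for at most one [t]. *)
Lemma Rintegral_node_sqr_gt0 (R : realType) (m : nat) (eta gamma : R)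
    (j : 'I_m.+1) (x : R) : 0 < eta -> 0 < gamma -> 0 <= x <= 1 ->
  0 < \int[lebesgue_measure]_(t in `[0, 1])
    (rl_weight eta t * (node m gamma j t - x) ^+ 2).
Proof.
move=> h g x01.
pose f t := rl_weight eta t * (node m gamma j t - x) ^+ 2.
have f0 t : 0 <= f t by rewrite mulr_ge0 ?rl_weight_ge0 ?sqr_ge0.
have intf : lebesgue_measure.-integrable `[0%R, 1%R] (EFin \o f).
  exact: (integrable_rl_weight_node j h g (bounded_measurable01_sqr x01)).
rewrite lt_neqAle Rintegral_ge0 ?andbT; last by move=> t _; exact: f0.
apply/eqP => /esym I0.
have /ae_eq_integral_abs : (\int[lebesgue_measure]_(t in `[0%R, 1%R]) `|(EFin \o f) t| = 0)%E.
  under eq_integral do rewrite gee0_abs ?lee_fin//.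
  by rewrite -(fineK (integrable_fin_num _ intf))//; congr EFin.
case=> //; first exact: measurable_int intf.
move=> N [mN N0 subN].
(* By injectivity, at least one of the halves []0, 1/2[] and []1/2, 1[] contains no [t] whose node
   is [x]. *)
have [a [b [a0 ab b1 nx]]] : exists a b : R, [/\ 0 <= a, a < b, b <= 1 &
    forall t, a < t < b -> node m gamma j t <> x].
  have [[t t12 tx]|nt] := pselect (exists2 t : R, 0 < t < 2^-1 & node m gamma j t = x).
    exists 2^-1, 1; split=> //; try lra.
    by move=> u u12 ux; have := @node_inj R m gamma j t u g; rewrite tx ux; lra.
  exists 0, 2^-1; split=> //; try lra.
  by move=> t t12 tx; apply: nt; exists t.
(* The integrand is nonzero throughout []a, b[], so this interval of positive length lies in the
   null set [N]. *)
have : (lebesgue_measure (`]a, b[ : set R) <= lebesgue_measure N)%E.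
  apply: le_measure; rewrite ?inE// => t; rewrite /= in_itv/= => tab.
  apply: subN => /= H; move/andP : (tab) => [at_ tb].
  have t01 : (`[0, 1]%classic : set R) t.
    by rewrite /= in_itv/=; apply/andP; split; lra.
  have [/eqP] := H t01; rewrite /f mulf_eq0 sqrf_eq0 subr_eq0 (negbTE (introN eqP (nx _ tab))) orbF.
  by rewrite gt_eqF// /rl_weight divr_gt0 ?powR_gt0 ?Gamma_gt0//; lra.
by rewrite N0 lebesgue_measure_itv/= lte_fin ab -EFinB lee_fin subr_le0 leNgt ab.
Qed.

(** If a sum of nonnegative terms with positive integrals vanished, all [basis_q] would vanish,
    against their sum being 1. *)
Lemma second_moment_gt0 (R : realType) (m : nat) (eta gamma alpha : R) (s : nat)
    (x : R) : 0 < eta -> 0 < gamma -> 0 <= alpha <= 1 -> 0 <= x <= 1 ->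
  0 < second_moment m eta gamma alpha s x.
Proof.
move=> h g ha hx; rewrite mulr_gt0 ?Gamma_gt0 ?addr_gt0//.
have q0 j : 0 <= basis_q m alpha s j x by exact: basis_q_ge0.
have T0 (j : 'I_m.+1) : true -> 0 <= basis_q m alpha s j x *
    \int[lebesgue_measure]_(t in `[0, 1]) (rl_weight eta t * (node m gamma j t - x) ^+ 2).
  by move=> _; rewrite mulr_ge0// ltW// Rintegral_node_sqr_gt0.
rewrite lt_neqAle sumr_ge0// andbT eq_sym psumr_eq0//.
apply/negP => /allP z.
have := sum_basis_q m alpha s x; rewrite big1; first by move/eqP; rewrite eq_sym oner_eq0.
move=> j _; apply/eqP; have := z j (mem_index_enum _).
by rewrite /= mulf_eq0 (gt_eqF (Rintegral_node_sqr_gt0 _ _ _ _))// orbF.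
Qed.

(** * Univariate error estimate from a modulus of continuity *)

Lemma bounded_measurable01_affine (R : realType) (c k : R) (f : R -> R) :
  bounded_measurable01 f -> bounded_measurable01 (fun u => c + k * f u).
Proof.
move=> [mf [M fM]]; split.
  by apply: measurable_funD => //; exact: measurable_funM.
exists (`|c| + `|k| * M) => u u01.
by rewrite (le_trans (ler_normD _ _))// lerD2l normrM ler_wpM2l// fM.
Qed.

Lemma dist_le_mul_modulus (R : realType) (f : R -> R) (delta M : R) :
  (forall u v, 0 <= u <= 1 -> 0 <= v <= 1 -> `|u - v| <= delta -> `|f u - f v| <= M) ->
  forall (n : nat) u v, 0 <= u <= 1 -> 0 <= v <= 1 -> `|u - v| <= n%:R * delta ->
  `|f u - f v| <= n%:R * M.
Proof.
move=> fM; elim=> [|n IHn] u v u01 v01.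
  by rewrite !mul0r normr_le0 subr_eq0 => /eqP ->; rewrite subrr normr0.
move=> uv; have n1 : 0 < n.+1%:R :> R by [].
(* [w] splits the segment from [v] to [u] in the ratio [n : 1]: one step of length at most [delta]
   remains, and induction covers the other [n]. Convexity keeps [w] in [[0, 1]]. *)
pose w := v + (u - v) * (n%:R / n.+1%:R).
have q0 : 0 <= n%:R / n.+1%:R :> R by rewrite divr_ge0.
have q1 : n%:R / n.+1%:R <= 1 :> R by rewrite ler_pdivrMr// mul1r ler_nat.
have w01 : 0 <= w <= 1.
  rewrite /w; move: q0 q1; set q := n%:R / _ => q0 q1.
  by case/andP: u01 => u0 u1; case/andP: v01 => v0 v1; apply/andP; split; nra.
have uw : `|u - w| <= delta.
  have -> : u - w = (u - v) / n.+1%:R.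
    by rewrite /w; field; rewrite -natr1 in n1; rewrite gt_eqF// addrC natr1.
  by rewrite normrM [X in _ * X]gtr0_norm ?invr_gt0// ler_pdivrMr// mulrC.
have wv : `|w - v| <= n%:R * delta.
  rewrite /w addrAC subrr add0r normrM (ger0_norm q0) mulrCA.
  by rewrite ler_wpM2l// ler_pdivrMr// mulrC.
rewrite -natr1 mulrDl mul1r [leRHS]addrC (le_trans (ler_distD (f w) _ _))// lerD//.
  exact: fM.
exact: IHn.
Qed.

Lemma dist_le_quadratic_modulus (R : realType) (f : R -> R) (delta M : R) : 0 < delta ->
  (forall u v, 0 <= u <= 1 -> 0 <= v <= 1 -> `|u - v| <= delta -> `|f u - f v| <= M) ->
  forall u v, 0 <= u <= 1 -> 0 <= v <= 1 ->
  `|f u - f v| <= M + M / delta ^+ 2 * (u - v) ^+ 2.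
Proof.
move=> d0 fM u v u01 v01.
(* Taking both points equal in [fM] shows that [M] is nonnegative. *)
have M0 : 0 <= M by have := fM u u u01 u01; rewrite !subrr !normr0; apply; exact: ltW.
pose l := `|u - v| / delta.
have l0 : 0 <= l by rewrite divr_ge0// ltW.
have -> : M + M / delta ^+ 2 * (u - v) ^+ 2 = (1 + l ^+ 2) * M.
  by rewrite /l expr_div_n real_normK ?num_real//; field; rewrite gt_eqF.
have [l1|l1] := leP l 1.
  rewrite (@le_trans _ _ M) ?fM//; first by move: l1; rewrite /l ler_pdivrMr// mul1r.
  by have := sqr_ge0 l; nra.
have ln : l <= (Num.truncn l).+1%:R by rewrite ltW// truncnS_gt.
have nl : (Num.truncn l)%:R <= l by rewrite truncn_le.
apply: (@le_trans _ _ ((Num.truncn l).+1%:R * M)).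
  apply: (dist_le_mul_modulus fM) => //.
  by rewrite -ler_pdivrMr.
(* The number of steps is at most [l + 1], hence at most [1 + l ^+ 2] because [l > 1]. *)
by rewrite ler_wpM2r// -natr1; nra.
Qed.

(** [f] lies between the quadratics [f x - M - k * (u - x) ^+ 2] and [f x + M + k * (u - x) ^+ 2].
    The operator is monotone and is evaluated exactly on both, [k] times the second moment being
    [M]. *)
Lemma op1_dist_le (R : realType) (m : nat) (eta gamma alpha : R) (s : nat) (x : R)
    (f : R -> R) (M : R) :
  0 < eta -> 0 < gamma -> 0 <= alpha <= 1 -> 0 <= x <= 1 -> bounded_measurable01 f ->
  (forall u v, 0 <= u <= 1 -> 0 <= v <= 1 ->
    `|u - v| <= Num.sqrt (second_moment m eta gamma alpha s x) -> `|f u - f v| <= M) ->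
  `|op1 m eta gamma alpha s f x - f x| <= 2 * M.
Proof.
move=> h g ha hx bf fM.
have sm0 := second_moment_gt0 m s h g ha hx.
have := @dist_le_quadratic_modulus R f _ M _ fM; rewrite sqrtr_gt0 => /(_ sm0).
rewrite sqr_sqrtr ?(ltW sm0)//; set k := M / _ => fq.
have bq := bounded_measurable01_sqr hx.
have E c b : op1 m eta gamma alpha s (fun u => c + b * (u - x) ^+ 2) x =
    c + b * second_moment m eta gamma alpha s x by exact: op1_affine.
have kE : k * second_moment m eta gamma alpha s x = M by rewrite divfK ?gt_eqF.
rewrite ler_distl; apply/andP; split.
  have -> : f x - 2 * M = (f x - M) + (- k) * second_moment m eta gamma alpha s x.
    by rewrite mulNr kE; ring.
  rewrite -E; apply: op1_le => //; first exact: bounded_measurable01_affine.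
  by move=> u u01; have := fq u x u01 hx; rewrite ler_distl => /andP[]; lra.
have -> : f x + 2 * M = (f x + M) + k * second_moment m eta gamma alpha s x.
  by rewrite kE; ring.
rewrite -E; apply: op1_le => //; first exact: bounded_measurable01_affine.
by move=> u u01; have := fq u x u01 hx; rewrite ler_distl => /andP[]; lra.
Qed.

(** * The bivariate operator *)

Definition clamp01 (R : realType) (t : R) : R := Num.max 0 (Num.min t 1).

Lemma clamp01_itv (R : realType) (t : R) : 0 <= clamp01 t <= 1.
Proof. by rewrite /clamp01 le_max lexx/= ge_max ler01/= ge_min lexx orbT. Qed.

Lemma clamp01_id (R : realType) (t : R) : 0 <= t <= 1 -> clamp01 t = t.
Proof. by move=> /andP[t0 t1]; rewrite /clamp01 (min_idPl t1); exact/max_idPr. Qed.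

Lemma continuous_clamp01 (R : realType) : continuous (@clamp01 R).
Proof.
move=> t; apply: (@continuous_max _ _ (cst 0) (fun t : R => Num.min t 1)).
  exact: cst_continuous.
apply: (@continuous_min _ _ id (cst 1)); first exact: cvg_id.
exact: cst_continuous.
Qed.

(** Composing with the retraction onto the square gives a function continuous and bounded on the
    whole plane, whatever [phi] does outside the square. *)
Definition extend01 (R : realType) (phi : R * R -> R) (p : R * R) : R :=
  phi (clamp01 p.1, clamp01 p.2).

Section extend01_theory.
Context {R : realType} (phi : R * R -> R).
Hypothesis hphi : {within (`[0, 1] `*` `[0, 1] : set (R * R)), continuous phi}.

Let square_clamp (p : R * R) :
  (`[0, 1] `*` `[0, 1] : set (R * R)) (clamp01 p.1, clamp01 p.2).
Proof. by split; rewrite /= in_itv/= clamp01_itv. Qed.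

Lemma extend01E (u v : R) : 0 <= u <= 1 -> 0 <= v <= 1 ->
  extend01 phi (u, v) = phi (u, v).
Proof. by move=> u01 v01; rewrite /extend01/= !clamp01_id. Qed.

Lemma continuous_extend01 : continuous (extend01 phi).
Proof.
move=> p; have := hphi; move/subspace_continuousP => /(_ _ (square_clamp p)) cphi.
pose c (q : R * R) := (clamp01 q.1, clamp01 q.2).
have cc : c q @[q --> p] --> c p.
  apply: (@cvg_pair _ _ _ _ (nbhs (clamp01 p.1)) (nbhs (clamp01 p.2))).
    by apply: (@continuous_comp _ _ _ fst (@clamp01 R)); [exact: cvg_fst|exact: continuous_clamp01].
  by apply: (@continuous_comp _ _ _ snd (@clamp01 R)); [exact: cvg_snd|exact: continuous_clamp01].
(* Continuity within the square controls [phi] only at points of the square, and all clamped points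
   are such. *)
move=> N /cphi; rewrite /nbhs/= /within/= => H.
have := cc _ H; rewrite /nbhs /=; apply: filterS => q /=; apply.
exact: square_clamp.
Qed.

Lemma bounded_extend01 : exists M : R, forall p, `|extend01 phi p| <= M.
Proof.
have cS : compact (`[0, 1] `*` `[0, 1] : set (R * R)).
  by apply: compact_setX; exact: segment_compact.
have /compact_bounded[M [_ HM]] := continuous_compact hphi cS.
exists (M + 1) => p; apply: (HM (M + 1)); first by rewrite ltrDl.
by exists (clamp01 p.1, clamp01 p.2); first exact: square_clamp.
Qed.

Lemma continuous_extend01_l (v : R) : continuous (fun u => extend01 phi (u, v)).
Proof.
move=> u; apply: (@continuous_comp _ _ _ (fun u => (u, v)) (extend01 phi)).
  by apply: (@cvg_pair _ _ _ _ (nbhs u) (nbhs v)); [exact: cvg_id|exact: cvg_cst].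
exact: continuous_extend01.
Qed.

Lemma continuous_extend01_r (u : R) : continuous (fun v => extend01 phi (u, v)).
Proof.
move=> v; apply: (@continuous_comp _ _ _ (fun v => (u, v)) (extend01 phi)).
  by apply: (@cvg_pair _ _ _ _ (nbhs u) (nbhs v)); [exact: cvg_cst|exact: cvg_id].
exact: continuous_extend01.
Qed.

Lemma bounded_measurable01_extend01_l (v : R) :
  bounded_measurable01 (fun u => extend01 phi (u, v)).
Proof.
split; first by apply: continuous_measurable_fun; exact: continuous_extend01_l.
by have [M HM] := bounded_extend01; exists M.
Qed.

Lemma bounded_measurable01_extend01_r (u : R) :
  bounded_measurable01 (fun v => extend01 phi (u, v)).
Proof.
split; first by apply: continuous_measurable_fun; exact: continuous_extend01_r.
by have [M HM] := bounded_extend01; exists M.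
Qed.

(** The integral depends continuously on [v] by dominated convergence, with [M] times the weight
    dominating for all [v]; this makes the outer operator applicable. *)
Lemma bounded_measurable01_Rintegral_node (m : nat) (eta gamma : R) (j : 'I_m.+1) :
  0 < eta -> 0 < gamma ->
  bounded_measurable01 (fun v => \int[lebesgue_measure]_(t in `[0, 1])
    (rl_weight eta t * extend01 phi (node m gamma j t, v))).
Proof.
move=> h g; have [M HM] := bounded_extend01.
have iw := integrable_rl_weight h.
have iM : lebesgue_measure.-integrable `[0%R, 1%R]
    (EFin \o (fun t => rl_weight eta t * M)) by exact: (integrableZr _ M iw).
have iphi v := integrable_rl_weight_node j h g (bounded_measurable01_extend01_l v).
have leM t v : `|rl_weight eta t * extend01 phi (node m gamma j t, v)| <= rl_weight eta t * M.
  by rewrite normrM ger0_norm ?rl_weight_ge0// ler_wpM2l ?rl_weight_ge0.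
split.
  apply: continuous_measurable_fun => v.
  (* Continuity under the integral is stated over an open interval of parameters; any one around [v]
     serves. *)
  have vI : v \in (`]v - 1, v + 1[%classic : set R).
    by rewrite inE/= in_itv/= ltrBlDr ltrDl ltr01.
  apply: (continuity_under_integral (mu := lebesgue_measure)
    (f := fun v t => rl_weight eta t * extend01 phi (node m gamma j t, v))
    (measurable_itv _) _ _ iM _ vI) => //.
  - apply: aeW => t _ u _; apply: cvgM; first exact: cvg_cst.
    exact: continuous_extend01_r.
  - by move=> u _; apply: aeW => t _; exact: leM.
exists (\int[lebesgue_measure]_(t in `[0, 1]) (rl_weight eta t * M)) => v _.
apply: le_trans (le_normr_Rintegral _ (iphi v)) _ => //.
by apply: le_Rintegral => //; exact: integrable_norm (iphi v).
Qed.

End extend01_theory.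

(** * The bivariate operator as two nested univariate ones *)

Lemma Rintegral_sum (d : measure_display) (T : measurableType d) (R : realType)
    (mu : {measure set T -> \bar R}) (D : set T) (I : Type) (r : seq I)
    (f : I -> T -> R) : measurable D -> (forall i, mu.-integrable D (EFin \o f i)) ->
  \int[mu]_(x in D) (\sum_(i <- r) f i x) = \sum_(i <- r) \int[mu]_(x in D) f i x.
Proof.
move=> mD fi; rewrite /Rintegral.
under eq_integral do rewrite -sumEFin.
rewrite integral_sum// sum_fine// => i _; apply: (integrable_fin_num _ (fi i)) => //.
Qed.

Lemma bounded_measurable01_lincomb (R : realType) (I : Type) (r : seq I) (c : I -> R)
    (f : I -> R -> R) : (forall i, bounded_measurable01 (f i)) ->
  bounded_measurable01 (fun v => \sum_(i <- r) c i * f i v).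
Proof.
move=> bf; split.
  by apply: measurable_sum => i; apply: measurable_funM => //; have [] := bf i.
have /choice[M fM] i : exists M : R, forall u, 0 <= u <= 1 -> `|f i u| <= M.
  by have [] := bf i.
exists (\sum_(i <- r) `|c i| * M i) => u u01.
rewrite (le_trans (ler_norm_sum _ _ _))// ler_sum// => i _.
by rewrite normrM ler_wpM2l// fM.
Qed.

Section op2_nested.
Context {R : realType} (phi : R * R -> R).
Hypothesis hphi : {within (`[0, 1] `*` `[0, 1] : set (R * R)), continuous phi}.
Variables (m1 m2 : nat) (eta1 eta2 gamma1 gamma2 alpha1 alpha2 : R) (s1 s2 : nat).
Hypotheses (heta1 : 0 < eta1) (heta2 : 0 < eta2)
  (hgamma1 : 0 < gamma1) (hgamma2 : 0 < gamma2).
Variable z : R.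

Let inner (j : 'I_m1.+1) (v : R) : R := \int[lebesgue_measure]_(t in `[0, 1])
  (rl_weight eta1 t * extend01 phi (node m1 gamma1 j t, v)).

Let bounded_measurable01_inner j : bounded_measurable01 (inner j).
Proof. exact: bounded_measurable01_Rintegral_node. Qed.

Lemma bounded_measurable01_op1_extend01 :
  bounded_measurable01
    (fun v => op1 m1 eta1 gamma1 alpha1 s1 (fun u => extend01 phi (u, v)) z).
Proof.
have := bounded_measurable01_affine 0 (Gamma (eta1 + 1))
  (bounded_measurable01_lincomb (index_enum 'I_m1.+1)
     (fun j => basis_q m1 alpha1 s1 j z) bounded_measurable01_inner).
by under eq_fun do rewrite add0r.
Qed.

(** The double integral in [op2] is already iterated, with the first variable inside, so only
    constants and finite sums have to be moved across the integrals. *)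
Lemma op2_nested (y : R) :
  op2 m1 m2 eta1 eta2 gamma1 gamma2 alpha1 alpha2 s1 s2 phi z y =
  op1 m2 eta2 gamma2 alpha2 s2
    (fun v => op1 m1 eta1 gamma1 alpha1 s1 (fun u => extend01 phi (u, v)) z) y.
Proof.
pose K j1 (j2 : 'I_m2.+1) := \int[lebesgue_measure]_(t in `[0, 1])
  (rl_weight eta2 t * inner j1 (node m2 gamma2 j2 t)).
transitivity (Gamma (eta1 + 1) * Gamma (eta2 + 1) *
  \sum_(j1 < m1.+1) \sum_(j2 < m2.+1)
    basis_q m1 alpha1 s1 j1 z * basis_q m2 alpha2 s2 j2 y * K j1 j2).
  congr (_ * _); apply: eq_bigr => j1 _; apply: eq_bigr => j2 _; congr (_ * _).
  apply: eq_Rintegral => t2; rewrite inE /= in_itv/= => t201.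
  rewrite /inner -RintegralZl//; last first.
    exact: integrable_rl_weight_node (bounded_measurable01_extend01_l hphi _).
  apply: eq_Rintegral => t1; rewrite inE /= in_itv/= => t101.
  (* The pair of nodes lies in the square, where [phi] and its extension agree. *)
  by rewrite extend01E ?node_itv01//; ring.
rewrite exchange_big/= -mulrA mulrCA; congr (_ * _).
rewrite mulr_sumr; apply: eq_bigr => j2 _.
transitivity (basis_q m2 alpha2 s2 j2 y *
  \sum_(j1 < m1.+1) Gamma (eta1 + 1) * basis_q m1 alpha1 s1 j1 z * K j1 j2).
  by rewrite !mulr_sumr; apply: eq_bigr => j1 _; ring.
congr (_ * _).
(* The sum over [j1] is taken inside the outer integral, where it assembles into the inner
   operator. *)
transitivity (\int[lebesgue_measure]_(t in `[0, 1]) \sum_(j1 < m1.+1)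
   (Gamma (eta1 + 1) * basis_q m1 alpha1 s1 j1 z) *
   (rl_weight eta2 t * inner j1 (node m2 gamma2 j2 t))).
  have iK j1 := integrable_rl_weight_node j2 heta2 hgamma2 (bounded_measurable01_inner j1).
  rewrite Rintegral_sum//; last first.
    move=> j1; exact: (integrableZl _ _ (iK j1)).
  apply: eq_bigr => j1 _; by rewrite (RintegralZl _ _ (iK j1)).
apply: eq_Rintegral => t _; rewrite /op1 mulrCA 2!mulr_sumr.
by apply: eq_bigr => j1 _; rewrite /inner; ring.
Qed.

End op2_nested.

(** * Increments of the extension against the partial moduli *)

Section moduli.
Context {R : realType} (phi : R * R -> R).
Hypothesis hphi : {within (`[0, 1] `*` `[0, 1] : set (R * R)), continuous phi}.

(** Boundedness of [phi] on the square bounds the set of increments by [M + M], so its [sup] is a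
    genuine upper bound. *)
Lemma dist_le_omega1 (rho x u v : R) : 0 <= x <= 1 -> 0 <= u <= 1 -> 0 <= v <= 1 ->
  `|u - v| <= rho -> `|extend01 phi (u, x) - extend01 phi (v, x)| <= omega1 phi rho.
Proof.
move=> x01 u01 v01 uv; rewrite !extend01E//.
have [M HM] := bounded_extend01 hphi.
apply: ub_le_sup; last first.
  by exists x, u, v; split; rewrite ?in_itv.
exists (M + M) => r [x' [u' [v' []]]]; rewrite !in_itv/= => x'01 u'01 v'01 _ ->.
by rewrite (le_trans (ler_normB _ _))// lerD// -extend01E.
Qed.

Lemma dist_le_omega2 (rho x u v : R) : 0 <= x <= 1 -> 0 <= u <= 1 -> 0 <= v <= 1 ->
  `|u - v| <= rho -> `|extend01 phi (x, u) - extend01 phi (x, v)| <= omega2 phi rho.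
Proof.
move=> x01 u01 v01 uv; rewrite !extend01E//.
have [M HM] := bounded_extend01 hphi.
apply: ub_le_sup; last first.
  by exists x, u, v; split; rewrite ?in_itv.
exists (M + M) => r [x' [u' [v' []]]]; rewrite !in_itv/= => x'01 u'01 v'01 _ ->.
by rewrite (le_trans (ler_normB _ _))// lerD// -extend01E.
Qed.

End moduli.

Theorem theorem8 (R : realType) (m1 m2 : nat) (hm1 : (0 < m1)%N) (hm2 : (0 < m2)%N)
    (eta1 eta2 : R) (heta1 : 0 < eta1) (heta2 : 0 < eta2)
    (gamma1 gamma2 : R) (hgamma1 : 0 < gamma1) (hgamma2 : 0 < gamma2)
    (alpha1 alpha2 : R) (halpha1 : 0 <= alpha1 <= 1) (halpha2 : 0 <= alpha2 <= 1)
    (s1 s2 : nat) (phi : R * R -> R)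
    (hphi : {within `[0, 1] `*` `[0, 1], continuous phi})
    (z y : R) (hz : z \in `[0, 1]) (hy : y \in `[0, 1]) :
  `|op2 m1 m2 eta1 eta2 gamma1 gamma2 alpha1 alpha2 s1 s2 phi z y - phi (z, y)|
  <= 2 * (omega1 phi (Num.sqrt (second_moment m1 eta1 gamma1 alpha1 s1 z))
          + omega2 phi (Num.sqrt (second_moment m2 eta2 gamma2 alpha2 s2 y))).
Proof.
move: hz hy; rewrite !in_itv/= => z01 y01.
rewrite op2_nested// -(@extend01E _ phi)//.
set W1 := omega1 _ _; set W2 := omega2 _ _.
(* The error splits at the slice [F]: replacing [A] by [F] under the second operator costs [2 * W1],
   and the second operator moves [F y] by at most [2 * W2]. *)
pose A v := op1 m1 eta1 gamma1 alpha1 s1 (fun u => extend01 phi (u, v)) z.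
pose F v := extend01 phi (z, v).
have bA : bounded_measurable01 A by exact: bounded_measurable01_op1_extend01.
have bF : bounded_measurable01 F by exact: bounded_measurable01_extend01_r.
have AF v : 0 <= v <= 1 -> `|A v - F v| <= 2 * W1.
  move=> v01; apply: op1_dist_le => //; first exact: bounded_measurable01_extend01_l.
  by move=> u w u01 w01 uw; exact: dist_le_omega1.
have E2 : `|op1 m2 eta2 gamma2 alpha2 s2 F y - F y| <= 2 * W2.
  apply: op1_dist_le => // u w u01 w01 uw; exact: dist_le_omega2.
have E1 c : op1 m2 eta2 gamma2 alpha2 s2 (fun v => c + 1 * F v) y =
    c + 1 * op1 m2 eta2 gamma2 alpha2 s2 F y by exact: op1_affine.
(* The bound [AF] is uniform in [v], so monotonicity and preservation of constants carry it through
   the second operator. *)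
have up : op1 m2 eta2 gamma2 alpha2 s2 A y <=
    op1 m2 eta2 gamma2 alpha2 s2 (fun v => 2 * W1 + 1 * F v) y.
  apply: op1_le => //; first exact: bounded_measurable01_affine.
  by move=> v /AF; rewrite ler_distl => /andP[]; lra.
have lo : op1 m2 eta2 gamma2 alpha2 s2 (fun v => - (2 * W1) + 1 * F v) y <=
    op1 m2 eta2 gamma2 alpha2 s2 A y.
  apply: op1_le => //; first exact: bounded_measurable01_affine.
  by move=> v /AF; rewrite ler_distl => /andP[]; lra.
move: up lo E2; rewrite !E1 -/A -/(F y) !ler_distl => up lo /andP[E2l E2u].
by apply/andP; split; lra.
Qed.
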